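(* Let $\mathcal H$ be a finite-dimensional real Hilbert space, $\mathcal A:\mathcal H\to 2^{\mathcal H}$ a maximally monotone operator, $\mathcal Q$ an arbitrary linear operator (square matrix) on $\mathcal H$, and let $\mathcal T:=(\mathcal A+\mathcal Q)^{-1}\mathcal Q$ be the metric resolvent. Then the following hold. (i) $\mathcal T$ is $\mathcal Q$-partly nonexpansive, i.e. $\mathcal Q$-based $1$-cocoercive: $\|\mathcal Tb_1-\mathcal Tb_2\|_{\mathcal Q}^2\le\langle b_1-b_2\,|\,\mathcal Tb_1-\mathcal Tb_2\rangle_{\mathcal Q}$ for all $b_1,b_2\in\mathcal H$. (ii) If $\mathcal Q$ is symmetric, then $\mathcal T$ is $\mathcal Q$-firmly nonexpansive, i.e. $\mathcal T\in\mathcal F^{\mathcal Q}_{1,\frac12}$. (iii) If $\mathcal Q$ is symmetric and positive definite, then $\mathcal T$ can be equivalently expressed as $$\mathcal T=\mathcal J_{\mathcal Q^{-1}\circ\mathcal A}=\mathcal Q^{-1}\circ\mathcal J_{\mathcal A\circ\mathcal Q^{-1}}\circ\mathcal Q=\mathcal Q^{-\frac12}\circ\mathcal J_{\mathcal Q^{-\frac12}\circ\mathcal A\circ\mathcal Q^{-\frac12}}\circ\mathcal Q^{\frac12}.$$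
   Context: For a square matrix $\mathcal Q$ on $\mathcal H$ (not assumed symmetric or positive semi-definite): $\langle a|b\rangle_{\mathcal Q}:=\langle\mathcal Qa|b\rangle$ and $\|a\|_{\mathcal Q}^2:=\langle\mathcal Qa|a\rangle$ (which may be negative). $\mathcal T=(\mathcal A+\mathcal Q)^{-1}\mathcal Q$, also written $(\mathcal I+\mathcal Q^{-1}\mathcal A)^{-1}=:\mathcal J_{\mathcal Q^{-1}\mathcal A}$; thus $a=\mathcal Tb$ means $\mathcal Qb\in\mathcal Aa+\mathcal Qa$. For an operator $\mathcal B$, $\mathcal J_{\mathcal B}:=(\mathcal I+\mathcal B)^{-1}$ is its resolvent, where $\mathcal I$ is the identity. An operator $\mathcal K:\mathcal H\to\mathcal H$ is $\mathcal Q$-based $\xi$-Lipschitz continuous if $\|\mathcal Kb_1-\mathcal Kb_2\|_{\mathcal Q}^2\le\xi^2\|b_1-b_2\|_{\mathcal Q}^2$ for all $b_1,b_2\in\mathcal H$. For $\xi\in\,]0,+\infty[$ and $\alpha\in\,]0,1[$, $\mathcal T\in\mathcal F^{\mathcal Q}_{\xi,\alpha}$ ($\mathcal T$ is $\mathcal Q$-based $\xi$-Lipschitz $\alpha$-averaged) means that there is a $\mathcal Q$-based $\xi$-Lipschitz continuous operator $\mathcal K:\mathcal H\to\mathcal H$ with $\mathcal T=(1-\alpha)\mathcal I+\alpha\mathcal K$.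
   Formalization: For arbitrary Q the operator T may be empty- or multi-valued (e.g. Q=0, A=0), so (i) is stated for all values of T at b1, b2, and (ii) is stated with a set-valued K in general and literally, with K: H→H, when T is an everywhere defined single-valued map. *)

(* Defs.v *)
From HB Require Import structures.
From mathcomp Require Import all_boot all_order all_algebra.
From mathcomp Require Import boolp classical_sets reals.

Set Implicit Arguments.
Unset Strict Implicit.
Unset Printing Implicit Defensive.

Import Order.TTheory GRing.Theory Num.Theory.
Local Open Scope classical_set_scope.
Local Open Scope ring_scope.

Section SetValuedOperators.
Variables (R : realType) (H : lmodType R).
Implicit Types (B C : H -> set H).

(* A function is identified with the operator having singleton values. *)
Definition op_fun (f : H -> H) : H -> set H := fun x => [set f x].

Definition op_id : H -> set H := op_fun id.

Definition op_inv B : H -> set H := fun y => [set x | B x y].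

Definition op_add B C : H -> set H :=
  fun x => [set u + v | u in B x & v in C x].

Definition op_scale (c : R) B : H -> set H := fun x => [set c *: u | u in B x].

Definition op_comp B C : H -> set H := fun x => \bigcup_(y in C x) B y.

Definition resolvent B : H -> set H := op_inv (op_add op_id B).

End SetValuedOperators.

Notation "B \oo C" := (op_comp B C)
  (at level 50, left associativity, format "B  \oo  C").

Section Metric.
Variables (R : realType) (H : vectType R) (ip : {dot H for idfun}).
Implicit Types (A B T K : H -> set H) (Q S : 'End(H)).

Definition monotone A : Prop :=
  forall x y u v, A x u -> A y v -> 0 <= ip (u - v) (x - y).

Definition maximally_monotone A : Prop :=
  monotone A /\
  forall B, monotone B -> (forall x, A x `<=` B x) -> forall x, B x = A x.

Definition qip Q (a b : H) : R := ip (Q a) b.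

Definition qnorm2 Q (a : H) : R := qip Q a a.

Definition metric_resolvent A Q : H -> set H :=
  op_inv (op_add A (op_fun Q)) \oo op_fun Q.

(* For arbitrary Q the metric resolvent may be empty- or multi-valued, so the
   inequality is required for all values that T takes at b1 and b2. *)
Definition partly_nonexpansive Q T : Prop :=
  forall b1 b2 a1 a2, T b1 a1 -> T b2 a2 ->
    qnorm2 Q (a1 - a2) <= qip Q (b1 - b2) (a1 - a2).

Definition lipschitz Q (xi : R) (k : H -> H) : Prop :=
  forall b1 b2, qnorm2 Q (k b1 - k b2) <= xi ^+ 2 * qnorm2 Q (b1 - b2).

Definition averaged Q (xi alpha : R) (t : H -> H) : Prop :=
  exists2 k : H -> H, lipschitz Q xi k &
    forall b, t b = (1 - alpha) *: b + alpha *: k b.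

(* Versions of the two previous notions for set-valued operators; they agree
   with them on everywhere defined single-valued operators. *)
Definition op_lipschitz Q (xi : R) K : Prop :=
  forall b1 b2 c1 c2, K b1 c1 -> K b2 c2 ->
    qnorm2 Q (c1 - c2) <= xi ^+ 2 * qnorm2 Q (b1 - b2).

Definition op_averaged Q (xi alpha : R) T : Prop :=
  exists2 K : H -> set H, op_lipschitz Q xi K &
    T = op_add (op_scale (1 - alpha) (@op_id R H)) (op_scale alpha K).

Definition self_adjoint Q : Prop := forall a b, ip (Q a) b = ip a (Q b).

Definition pos_semidefinite Q : Prop := forall a, 0 <= ip (Q a) a.

Definition pos_definite Q : Prop := forall a, a != 0 -> 0 < ip (Q a) a.

(* The principal square root; 0 is a junk value, used only when Q has none. *)
Definition op_sqrt Q : 'End(H) :=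
  xget 0 [set S | [/\ self_adjoint S, pos_semidefinite S & (S \o S)%VF = Q]].

End Metric.

(* Main.v *)
(* A value a of T at b is characterized by Q b - Q a \in A a; monotonicity of A
   then gives cocoercivity, and for symmetric Q the expansion of
   |2 (a1 - a2) - (b1 - b2)|_Q^2 shows that the reflection 2 T - I is
   Q-nonexpansive.  For any factorization Q = L \o S into invertible maps,
   T = S^-1 \o J_(L^-1 \o A \o S^-1) \o S.  The square root of a positive
   definite Q is a polynomial in Q: by self-adjointness the minimal polynomial
   of Q is a product of distinct X - x with x > 0. *)

Require Import Defs.
From HB Require Import structures.
From mathcomp Require Import all_boot all_order all_algebra.
From mathcomp Require Import complex.
From mathcomp Require Import ring lra.
From mathcomp Require Import boolp classical_sets reals.

Set Implicit Arguments.
Unset Strict Implicit.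
Unset Printing Implicit Defensive.

Import Order.TTheory GRing.Theory Num.Theory.
Local Open Scope classical_set_scope.
Local Open Scope ring_scope.

(** * Interpolation and splitting of real polynomials *)

Section RealPolynomials.
Variable R : rcfType.
Implicit Types (p q : {poly R}) (s : seq R).

(** Newton's scheme: a new node [y] is matched by adding a multiple of the product [w] of the
    earlier linear factors, which vanishes at the earlier nodes but not at [y]. *)
Lemma poly_interpolation s (f : R -> R) :
  uniq s -> exists q, forall x, x \in s -> q.[x] = f x.
Proof.
elim: s => [_|y s IH /= /andP[ys us]]; first by exists 0.
have [q qf] := IH us.
pose w := \prod_(z <- s) ('X - z%:P).
have wy : w.[y] != 0 by rewrite -[_ == 0]/(root w y) root_prod_XsubC.
exists (q + ((f y - q.[y]) / w.[y]) *: w) => x; rewrite inE hornerD hornerZ.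
case/predU1P => [->|xs]; first by rewrite divfK// addrC subrK.
have /rootP-> : root w x by rewrite root_prod_XsubC.
by rewrite mulr0 addr0 qf.
Qed.

(** As [p] is real, the conjugate is a root too, distinct because [y != 0]. The quadratic is the
    product of the two linear factors, and divisibility over [R[i]] descends to [R]. *)
Lemma dvdp_of_nonreal_root p (x y : R) :
  y != 0 -> root (map_poly (real_complex R) p) (x +i* y)%C ->
  ('X - x%:P) ^+ 2 + (y ^+ 2)%:P %| p.
Proof.
move=> y0 rz.
have rzc : root (map_poly (real_complex R) p) (x -i* y)%C.
  rewrite -[(x -i* y)%C]/((x +i* y)^*)%C -complex_root_conj -map_poly_comp/=.
  by rewrite (eq_map_poly (g := real_complex R)) // => t /=; rewrite oppr0.
rewrite -(dvdp_map (real_complex R)).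
have -> : map_poly (real_complex R) (('X - x%:P) ^+ 2 + (y ^+ 2)%:P) =
    \prod_(z <- [:: (x +i* y)%C; (x -i* y)%C]) ('X - z%:P).
  rewrite !big_cons big_nil mulr1 rmorphD/= rmorphXn/= rmorphB/=.
  rewrite map_polyX !map_polyC/=.
  have -> : (x +i* y)%C = x%:C%C + y%:C%C * 'i%C.
    by apply/eqP; rewrite eq_complex/=; apply/andP; split; apply/eqP; ring.
  have -> : (x -i* y)%C = x%:C%C - y%:C%C * 'i%C.
    by apply/eqP; rewrite eq_complex/=; apply/andP; split; apply/eqP; ring.
  have -> : (y ^+ 2)%:C%C = - (y%:C%C * 'i%C) ^+ 2.
    by rewrite exprMn sqr_i rmorphXn/= mulrN1 opprK.
  rewrite polyCN !polyCD polyCN rmorphXn/=; ring.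
apply: uniq_roots_dvdp; first by rewrite /= rz rzc.
rewrite uniq_rootsE /= inE andbT.
by rewrite eq_complex /= eqxx /= -subr_eq0 opprK -mulr2n mulrn_eq0.
Qed.

(* With [y = 0] the hypothesis excludes double roots, with [y != 0] pairs of
   conjugate roots. *)
Lemma monic_split_simple p : p \is monic ->
  (forall x y : R, ~~ (('X - x%:P) ^+ 2 + (y ^+ 2)%:P %| p)) ->
  exists2 s, uniq s & p = \prod_(z <- s) ('X - z%:P).
Proof.
have [n] := ubnP (size p); elim: n p => // n IH p; rewrite ltnS => pn pm pq.
have [sp1|sp1] := eqVneq (size p) 1.
  exists [::] => //; rewrite big_nil; have/eqP/size_poly1P[c c0 pE] := sp1.
  by move/monicP: pm; rewrite pE lead_coefC => ->.
have [|z rz] := closed_rootP (map_poly (real_complex R) p) _.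
  by rewrite size_map_poly.
case: z rz => x y rz.
have [y0|y0] := eqVneq y 0; last first.
  by have := pq x y; rewrite dvdp_of_nonreal_root.
have rx : root p x by move: rz; rewrite y0 -[(x +i* 0)%C]/(x%:C%C) fmorph_root.
have /factor_theorem[r pE] := rx.
have rm : r \is monic by rewrite -(monicMr _ (monicXsubC x)) -pE.
have [||s us rE] := IH r _ rm.
- rewrite (leq_trans _ pn) // pE size_Mmonic ?monic_neq0 ?monicXsubC //.
  by rewrite size_XsubC addn2.
- by move=> a b; apply: contra (pq a b) => d; rewrite pE dvdp_mulr.
exists (x :: s); last by rewrite big_cons pE rE mulrC.
(* If [x] occurred in [s], it would be a double root of [p]: the excluded case [y = 0]. *)
rewrite /= us andbT -root_prod_XsubC -rE.
apply: contra (pq x 0) => /factor_theorem[t tE].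
by rewrite pE tE expr0n addr0 expr2 -mulrA dvdp_mull.
Qed.

End RealPolynomials.

(** * Rules of computation for the inner product *)

Section DotProduct.
Variables (R : realType) (H : vectType R) (ip : {dot H for idfun}).
Implicit Types (u v : H) (Q S : 'End(H)).

Lemma dotC u v : ip u v = ip v u.
Proof. by rewrite hermC /= expr0 mul1r. Qed.

Lemma dot_ge0 u : 0 <= ip u u.
Proof.
by have [->|u0] := eqVneq u 0; rewrite ?linear0r // ltW // neq0_dnorm_gt0.
Qed.

Lemma dot_eq0 u : (ip u u == 0) = (u == 0).
Proof.
apply/idP/idP => [|/eqP->]; last by rewrite linear0r.
by apply: contraTT => u0; rewrite gt_eqF // neq0_dnorm_gt0.
Qed.

Lemma dotDl u v w : ip (u + v) w = ip u w + ip v w.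
Proof. exact: linearDl. Qed.

Lemma dotDr u v w : ip w (u + v) = ip w u + ip w v.
Proof. exact: linearDr. Qed.

Lemma dotBl u v w : ip (u - v) w = ip u w - ip v w.
Proof. exact: linearBl. Qed.

Lemma dotBr u v w : ip w (u - v) = ip w u - ip w v.
Proof. exact: linearBr. Qed.

Lemma dotZl c u w : ip (c *: u) w = c * ip u w.
Proof. exact: linearZl_LR. Qed.

Lemma dotZr c u w : ip w (c *: u) = c * ip w u.
Proof. by rewrite dotC dotZl dotC. Qed.

End DotProduct.

(** * Square roots of positive definite matrices *)

(* [M] acts on the right, as the matrix in the coordinates [phi] of an operator
   on the range of [phi]. *)
Section MatrixSquareRoot.
Variables (R : realType) (H : vectType R) (ip : {dot H for idfun}).
Variables (n : nat) (phi : {linear 'rV[R]_n.+1 -> H}) (M : 'M[R]_n.+1).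
Hypothesis phi_inj : injective phi.
Hypothesis M_sym :
  forall u v, ip (phi (u *m M)) (phi v) = ip (phi u) (phi (v *m M)).
Hypothesis M_pos : forall u : 'rV_n.+1, u != 0 -> 0 < ip (phi (u *m M)) (phi u).
Local Notation hmx := (horner_mx M).

Let phi_eq0 u : (phi u == 0) = (u == 0).
Proof. by rewrite -(raddf0 phi) (inj_eq phi_inj). Qed.

Lemma horner_mx_sym p u v :
  ip (phi (u *m hmx p)) (phi v) = ip (phi u) (phi (v *m hmx p)).
Proof.
elim/poly_ind: p u v => [|p c IH] u v.
  by rewrite rmorph0 !mulmx0 raddf0 linear0l linear0r.
rewrite rmorphD rmorphM /= horner_mx_X horner_mx_C.
rewrite !mulmxDr !mul_mx_scalar !(linearD phi) !(linearZ_LR phi) /=.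
rewrite dotDl dotDr dotZl dotZr.
(* Moving a product across the inner product reverses its factors; commutation restores their
   order. *)
have pM : hmx p *m M = M *m hmx p.
  have : hmx (p * 'X) = hmx ('X * p) by rewrite mulrC.
  by rewrite !rmorphM /= horner_mx_X.
by congr (_ + _); rewrite -[hmx p * M]/(hmx p *m M) {2}pM !mulmxA M_sym IH.
Qed.

(** If [r * p] annihilated [M], then [r * q] would divide it; cancelling [r], [q] would divide a
    nonzero polynomial of smaller degree. *)
Lemma horner_mx_proper_factor_neq0 (p q r : {poly R}) :
  mxminpoly M = r * q -> (size p < size q)%N -> p != 0 -> hmx (r * p) != 0.
Proof.
move=> mE pq p0; rewrite -dvd_mxminpoly mE.
have m0 : r * q != 0 by rewrite -mE monic_neq0 // mxminpoly_monic.
move: m0; rewrite mulf_eq0 negb_or => /andP[r0 q0].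
by rewrite dvdp_mul2l // gtNdvdp.
Qed.

(** Let [r] be the cofactor, [v] a row of [r(M)] and [w = v (M - x)]. Then [w (M - x) + y^2 v = 0];
    pairing with [v] gives [|w|^2 + y^2 |v|^2 = 0] by symmetry, so [w = 0]. Hence [r * (X - x)]
    annihilates [M], against minimality. *)
Lemma mxminpoly_no_square x y :
  ~~ (('X - x%:P) ^+ 2 + (y ^+ 2)%:P %| mxminpoly M).
Proof.
apply/negP => /dvdpP[r mE].
have sq : size (('X - x%:P) ^+ 2 + (y ^+ 2)%:P) = 3.
  rewrite size_polyDl size_exp_XsubC //.
  by rewrite (leq_ltn_trans (size_polyC_leq1 _)).
have/eqP : hmx (r * ('X - x%:P)) != 0.
  by apply: horner_mx_proper_factor_neq0 mE _ _; rewrite ?sq ?size_XsubC // polyXsubC_eq0.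
apply; apply/row_matrixP => i; rewrite row0 rowE.
set e := delta_mx _ _; set v := e *m hmx r; set w := v *m hmx ('X - x%:P).
have -> : e *m hmx (r * ('X - x%:P)) = w by rewrite rmorphM /= mulmxA.
have : e *m hmx (mxminpoly M) = 0 by rewrite mx_root_minpoly mulmx0.
rewrite mE rmorphM rmorphD /= expr2 rmorphM /= horner_mx_C mulmxA -/v.
rewrite mulmxDr mul_mx_scalar mulmxA -/w => wE.
have : ip (phi (w *m hmx ('X - x%:P) + y ^+ 2 *: v)) (phi v) = 0.
  by rewrite wE raddf0 linear0l.
rewrite (linearD phi) dotDl (linearZ_LR phi) /= dotZl horner_mx_sym -/w => /eqP.
rewrite paddr_eq0 ?dot_ge0 //; last first.
  by apply: mulr_ge0; [exact: sqr_ge0|exact: dot_ge0].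
rewrite dot_eq0 phi_eq0.
by case/andP => /eqP.
Qed.

(** With [r] the cofactor of [X - x], a nonzero row of [r(M)] is an eigenvector for [x], to which
    [M_pos] applies. *)
Lemma root_mxminpoly_gt0 x : root (mxminpoly M) x -> 0 < x.
Proof.
move=> /factor_theorem[r mE].
have r0 : hmx r != 0.
  rewrite -[r]mulr1; apply: horner_mx_proper_factor_neq0 mE _ _;
  by rewrite ?size_XsubC ?size_poly1 ?oner_eq0.
have [i ri] : exists i, row i (hmx r) != 0.
  apply/existsP; apply: contraR r0; rewrite negb_exists => /forallP r0.
  by apply/eqP/row_matrixP => i; rewrite row0; apply/eqP; rewrite -[_ == _]negbK r0.
set v := row i _ in ri.
have vM : v *m M = x *: v.
  apply/eqP; rewrite -subr_eq0 -mul_mx_scalar -mulmxBr /v rowE -mulmxA.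
  rewrite -{2}(horner_mx_X M) -(horner_mx_C M) -rmorphB.
  by rewrite -[hmx r *m _]/(hmx r * _) -rmorphM -mE /= mx_root_minpoly mulmx0.
by have := M_pos ri; rewrite vM (linearZ_LR phi) /= dotZl pmulr_lgt0 // neq0_dnorm_gt0 // phi_eq0.
Qed.

(* Interpolating the fourth root on the spectrum exhibits the square root as
   the square of a self-adjoint matrix, so that its positivity is immediate. *)
Lemma mx_sqrt_existsS : exists S : 'M[R]_n.+1,
  [/\ forall u v, ip (phi (u *m S)) (phi v) = ip (phi u) (phi (v *m S)),
      forall u, 0 <= ip (phi (u *m S)) (phi u) & S *m S = M].
Proof.
have [s us mE] := monic_split_simple (mxminpoly_monic M) mxminpoly_no_square.
have [q qs] := poly_interpolation (fun x => Num.sqrt (Num.sqrt x)) us.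
exists (hmx (q ^+ 2)); split=> [u v|u|]; first exact: horner_mx_sym.
  by rewrite expr2 rmorphM /= mulmxA horner_mx_sym dot_ge0.
rewrite -[_ *m _]/(_ * _) -rmorphM -[RHS]horner_mx_X; apply/eqP.
(* The roots of the minimal polynomial are simple, so it divides [q^4 - X] once [q(x)^4 = x] at each
   of them. *)
rewrite -subr_eq0 -rmorphB -dvd_mxminpoly mE.
apply: uniq_roots_dvdp; last by rewrite uniq_rootsE.
apply/allP => x xs; rewrite /root hornerD hornerN hornerX hornerM horner_exp qs //.
have x0 : 0 < x by apply: root_mxminpoly_gt0; rewrite mE root_prod_XsubC.
by rewrite sqr_sqrtr ?sqrtr_ge0 // -expr2 sqr_sqrtr ?ltW // subrr.
Qed.

End MatrixSquareRoot.

Lemma mx_sqrt_exists (R : realType) (H : vectType R) (ip : {dot H for idfun})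
    (n : nat) (phi : {linear 'rV[R]_n -> H}) (M : 'M[R]_n) :
  injective phi ->
  (forall u v, ip (phi (u *m M)) (phi v) = ip (phi u) (phi (v *m M))) ->
  (forall u : 'rV_n, u != 0 -> 0 < ip (phi (u *m M)) (phi u)) ->
  exists S : 'M[R]_n,
  [/\ forall u v, ip (phi (u *m S)) (phi v) = ip (phi u) (phi (v *m S)),
      forall u, 0 <= ip (phi (u *m S)) (phi u) & S *m S = M].
Proof.
case: n phi M => [|n] phi M; last exact: mx_sqrt_existsS.
exists 0; split=> [u v|u|]; last by apply/matrixP => -[].
  by rewrite !mulmx0 raddf0 linear0l linear0r.
by rewrite mulmx0 raddf0 linear0l.
Qed.

(** * The principal square root of an operator *)

Section OperatorSquareRoot.
Import VectorInternalTheory.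
Variables (R : realType) (H : vectType R) (ip : {dot H for idfun}).
Variable Q : 'End(H).
Hypotheses (Q_sym : self_adjoint ip Q) (Q_pos : pos_definite ip Q).

(** The coordinates [r2v] need not be orthonormal, so self-adjointness of [Q] becomes symmetry of
    [M] for the inner product pulled back along [r2v]. *)
Lemma sqrt_exists : exists S : 'End(H),
  [/\ self_adjoint ip S, pos_semidefinite ip S & (S \o S)%VF = Q].
Proof.
pose M := lin1_mx (v2r \o Q \o r2v).
have ME u : r2v (u *m M) = Q (r2v u) by rewrite mul_rV_lin1 /= v2rK.
have [|u v|u u0|S [S_sym S_pos SS]] := @mx_sqrt_exists _ _ ip _ r2v M.
- exact: can_inj r2vK.
- by rewrite /= !ME Q_sym.
- rewrite /= ME Q_pos //; apply: contra u0 => /eqP u0.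
  by rewrite -(r2vK u) u0 linear0.
pose f : {linear H -> H} := r2v \o mulmxr S \o v2r.
exists (linfun f); split=> [a b|a|].
- by rewrite !lfunE /= -{1}(v2rK b) S_sym /= v2rK.
- by rewrite lfunE /= -{2}(v2rK a) S_pos.
apply/lfunP => a; rewrite comp_lfunE !lfunE /= r2vK -mulmxA SS.
by rewrite mul_rV_lin1 /= !v2rK.
Qed.

Lemma op_sqrtP : (op_sqrt ip Q \o op_sqrt ip Q)%VF = Q.
Proof.
(* Existence of a root rules out the default value 0. *)
rewrite /op_sqrt; case: xgetP => [_ _ [_ _]|noS] //.
by have [S hS] := sqrt_exists; case: (noS S).
Qed.

Lemma pos_definite_lker0 : lker Q == 0%VS.
Proof.
apply/lker0P/raddf_inj => a Qa0; apply/eqP; apply: contraT => /Q_pos.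
by rewrite Qa0 linear0l ltxx.
Qed.

Lemma op_sqrt_lker0 : lker (op_sqrt ip Q) == 0%VS.
Proof.
apply/lker0P/raddf_inj => a Sa0; apply: (lker0P pos_definite_lker0).
by rewrite -op_sqrtP !comp_lfunE /= Sa0 !linear0.
Qed.

End OperatorSquareRoot.

(** * Factorizations and averagedness of the metric resolvent *)

Section MetricResolvent.
Variables (R : realType) (H : vectType R) (ip : {dot H for idfun}).
Variables (A : H -> set H) (Q : 'End(H)).
Local Notation T := (metric_resolvent A Q).

Lemma metric_resolventE b a : T b a <-> A a (Q b - Q a).
Proof.
split=> [[_ -> [u Au [_ -> uE]]]|Aa]; first by rewrite -uE addrK.
exists (Q b) => //; exists (Q b - Q a) => //; exists (Q a) => //.
by rewrite subrK.
Qed.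

Lemma resolventE (B : H -> set H) b a : resolvent B b a <-> B a (b - a).
Proof.
split=> [[_ -> [u Bu <-]]|Ba]; first by rewrite addrC addKr.
by exists a => //; exists (b - a) => //; rewrite addrC subrK.
Qed.

Lemma op_comp_funl (f : H -> H) (B : H -> set H) x z :
  (op_fun f \oo B) x z <-> exists2 y, B x y & z = f y.
Proof. by split=> [[y By ->]|[y By ->]]; exists y. Qed.

Lemma op_comp_funr (f : H -> H) (B : H -> set H) x z :
  (B \oo op_fun f) x z <-> B (f x) z.
Proof. by split=> [[y -> ]|Bz] //; exists (f x). Qed.

Lemma op_ext (B C : H -> set H) : (forall x y, B x y <-> C x y) -> B = C.
Proof. by move=> BC; apply/funext => x; apply/funext => y; apply/propext. Qed.

Lemma op_comp_idl (B : H -> set H) : op_fun idfun \oo B = B.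
Proof.
by apply: op_ext => x y; rewrite op_comp_funl; split=> [[z Bz ->]|] //; exists y.
Qed.

Lemma op_comp_idr (B : H -> set H) : B \oo op_fun idfun = B.
Proof. by apply: op_ext => x y; rewrite op_comp_funr. Qed.

(* The three expressions of T come from the factorizations Q = Q \o id,
   Q = id \o Q and Q = Q^(1/2) \o Q^(1/2). *)
Lemma metric_resolvent_factor (L : {additive H -> H}) (Li S Si : H -> H) :
  Q =1 L \o S -> cancel L Li -> cancel Li L -> cancel S Si -> cancel Si S ->
  T = op_fun Si \oo resolvent (op_fun Li \oo A \oo op_fun Si) \oo op_fun S.
Proof.
move=> QE LK LiK SK SiK; apply: op_ext => b a.
(* Additivity of [L] turns [Q b - Q a] into [L (S b - S a)]; the value of the inner resolvent at
   [S b] is then [S a]. *)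
rewrite metric_resolventE op_comp_funr op_comp_funl !QE /= -raddfB; split.
  move=> Aa; exists (S a); rewrite ?SK //.
  apply/resolventE/op_comp_funr; rewrite SK.
  by apply/op_comp_funl; exists (L (S b - S a)); rewrite ?LK.
move=> [c /resolventE/op_comp_funr/op_comp_funl[u Au cE] ->].
by rewrite SiK cE LiK.
Qed.

Hypothesis hA : monotone ip A.

Lemma metric_resolvent_partly_nonexpansive : partly_nonexpansive ip Q T.
Proof.
move=> b1 b2 a1 a2 /metric_resolventE Aa1 /metric_resolventE Aa2.
have := hA Aa1 Aa2; rewrite /qnorm2 /qip.
rewrite !(linearB Q) !dotBl; lra.
Qed.

Hypothesis Q_sym : self_adjoint ip Q.

(** For differences [a] and [b], symmetry merges the cross terms: [|2 a - b|_Q^2 = |b|_Q^2 + 4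
    (|a|_Q^2 - <b|a>_Q)], and cocoercivity makes the bracket nonpositive. *)
Lemma reflected_nonexpansive b1 b2 a1 a2 : T b1 a1 -> T b2 a2 ->
  qnorm2 ip Q ((2 *: a1 - b1) - (2 *: a2 - b2)) <= qnorm2 ip Q (b1 - b2).
Proof.
move=> T1 T2; have := metric_resolvent_partly_nonexpansive T1 T2.
rewrite (_ : 2 *: a1 - b1 - _ = 2 *: (a1 - a2) - (b1 - b2)); last first.
  by rewrite scalerBr !opprD addrACA.
move: (a1 - a2) (b1 - b2) => a b; rewrite /qnorm2 /qip.
rewrite (linearB Q) (linearZ_LR Q) /= dotBl !dotBr !dotZl !dotZr [ip (Q a) b]Q_sym.
rewrite [ip a (Q b)]dotC; lra.
Qed.

Lemma midpoint_reflection (a b : H) :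
  (1 - 1 / 2) *: b + (1 / 2) *: (2 *: a - b) = a.
Proof.
rewrite scalerBr scalerA (_ : 1 - 1 / 2 = 1 / 2 :> R); last by lra.
by rewrite addrC subrK mul1r mulVf ?pnatr_eq0 // scale1r.
Qed.

Lemma metric_resolvent_averaged : op_averaged ip Q 1 (1 / 2) T.
Proof.
(* The reflection [2 T - I] comes from solving [T = (1/2) I + (1/2) K] for [K]. *)
exists (fun b => [set 2 *: a - b | a in T b]).
  move=> b1 b2 _ _ [a1 T1 <-] [a2 T2 <-].
  by rewrite expr1n mul1r; exact: reflected_nonexpansive.
apply: op_ext => b a; split=> [Ta|].
  exists ((1 - 1 / 2) *: b); first by exists b.
  exists ((1 / 2) *: (2 *: a - b)); last exact: midpoint_reflection.
  by exists (2 *: a - b) => //; exists a.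
by move=> [_ [_ -> <-] [_ [_ [c Tc <-] <-] <-]]; rewrite midpoint_reflection.
Qed.

Lemma metric_resolvent_fun_averaged (t : H -> H) :
  T = op_fun t -> averaged ip Q 1 (1 / 2) t.
Proof.
move=> Tt; exists (fun b => 2 *: t b - b) => [b1 b2|b].
  by rewrite expr1n mul1r; apply: reflected_nonexpansive; rewrite Tt.
by rewrite midpoint_reflection.
Qed.

End MetricResolvent.

Theorem lemma2p1 (R : realType) (H : vectType R) (ip : {dot H for idfun})
    (A : H -> set H) (Q : 'End(H)) (hA : maximally_monotone ip A) :
  let T := metric_resolvent A Q in
  [/\ partly_nonexpansive ip Q T,
      self_adjoint ip Q ->
        op_averaged ip Q 1 (1 / 2) T /\
        (forall t : H -> H, T = op_fun t -> averaged ip Q 1 (1 / 2) t)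
    & self_adjoint ip Q -> pos_definite ip Q ->
        let Qi := op_fun (Q^-1)%VF in
        let Qh := op_fun (op_sqrt ip Q) in
        let Qhi := op_fun ((op_sqrt ip Q)^-1)%VF in
        [/\ T = resolvent (Qi \oo A),
            T = Qi \oo resolvent (A \oo Qi) \oo op_fun Q
          & T = Qhi \oo resolvent (Qhi \oo A \oo Qhi) \oo Qh]].
Proof.
have [mA _] := hA; split.
- exact: metric_resolvent_partly_nonexpansive.
- move=> Q_sym; split; first exact: metric_resolvent_averaged.
  by move=> t; apply: metric_resolvent_fun_averaged.
move=> Q_sym Q_pos Qi Qh Qhi.
have Q0 := pos_definite_lker0 Q_pos.
have S0 := op_sqrt_lker0 Q_sym Q_pos.
have [QK QiK] := (lker0_lfunK Q0, lker0_lfunVK Q0).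
have [SK SiK] := (lker0_lfunK S0, lker0_lfunVK S0).
split.
- have idK : cancel (@idfun H) idfun by [].
  rewrite (@metric_resolvent_factor _ _ A _ Q (Q^-1)%VF idfun idfun) //.
  by rewrite op_comp_idl !op_comp_idr.
- rewrite (@metric_resolvent_factor _ _ A _ idfun idfun Q (Q^-1)%VF) //.
  by rewrite op_comp_idl.
- apply: metric_resolvent_factor => // b.
  by rewrite -{1}(op_sqrtP Q_sym Q_pos) comp_lfunE.
Qed.
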